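(* Let $G$ be a countable group. If $G$ is abelian-by-finite or locally finite-by-abelian, then $G$ is bijectively coarsely equivalent to an abelian group.
   Context: All groups (including the abelian group in the conclusion) are countable and are endowed with proper left-invariant metrics (a metric is proper if all its closed balls are compact); such a metric exists on every countable group and any two such metrics on the same group are coarsely equivalent via the identity map. A map $f:X\to Y$ between metric spaces is bornologous if for every $\delta<\infty$ the number $\sup\{\mathrm{diam}(f(A)):A\subset X,\ \mathrm{diam}(A)\le\delta\}$ is finite. Metric spaces $X,Y$ are bijectively coarsely equivalent if there are bijective bornologous maps $f:X\to Y$, $g:Y\to X$ and a real constant $K$ with $\mathrm{dist}(g\circ f(x),x)\le K$ and $\mathrm{dist}(f\circ g(y),y)\le K$ for all $x\in X$, $y\in Y$. A group $G$ is $\mathcal P_1$-by-$\mathcal P_2$ if it contains a normal subgroup $H$ with property $\mathcal P_1$ whose quotient group $G/H$ has property $\mathcal P_2$. A group has a property $\mathcal P$ locally if each of its finitely generated subgroups has $\mathcal P$. Thus ''locally finite-by-abelian'' means that every finitely generated subgroup is finite-by-abelian. *)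

(* Defs.v *)
From HB Require Import structures.
From mathcomp Require Import all_boot all_order all_algebra.
From mathcomp Require Import monoid generic_quotient.
From mathcomp Require Import all_classical all_reals.
From mathcomp Require Import topology ereal.

Set Implicit Arguments.
Unset Strict Implicit.
Unset Printing Implicit Defensive.

Import Order.TTheory GRing.Theory Num.Theory.

Local Open Scope classical_set_scope.
Local Open Scope quotient_scope.

(* Subgroups of G are the library's [groupClosed G]; classically,
   every subset of G is a [{pred G}]. *)
HB.mixin Record isNormalClosed (G : groupType) (S : {pred G}) := {
  normal_closed : forall x y : G, y \in S -> (y ^ x)%g \in S
}.

#[short(type="normalClosed")]
HB.structure Definition NormalClosed (G : groupType) :=
  { S of isNormalClosed G S & GroupClosed G S }.

Section SubgroupType.
Variables (G : groupType) (H : groupClosed G).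
Local Open Scope group_scope.

Definition subgroup_of : Type := {x : G | x \in H}.

HB.instance Definition _ := SubType.copy subgroup_of {x : G | x \in H}.
HB.instance Definition _ := Choice.copy subgroup_of {x : G | x \in H}.

Lemma subgroup_of_closed : group_closed [pred x : G | x \in H].
Proof.
split; first exact: gpred1.
by move=> x y xH yH; apply: gpredM => //; apply: gpredVr.
Qed.

HB.instance Definition _ :=
  SubChoice_isSubGroup.Build G _ subgroup_of subgroup_of_closed.
End SubgroupType.

Section QuotientGroup.
Variables (G : groupType) (N : normalClosed G).
Local Open Scope group_scope.

Definition coset_rel (x y : G) : bool := x^-1 * y \in N.

Lemma coset_rel_refl : reflexive coset_rel.
Proof. by move=> x; rewrite /coset_rel mulVg; exact: gpred1. Qed.

Lemma coset_rel_sym : symmetric coset_rel.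
Proof.
have sub x y : coset_rel x y -> coset_rel y x.
  by rewrite /coset_rel => /gpredVr; rewrite invgM invgK.
by move=> x y; apply/idP/idP; exact: sub.
Qed.

Lemma coset_rel_trans : transitive coset_rel.
Proof.
move=> y x z xy yz; rewrite /coset_rel.
by rewrite -(mulgK y x^-1) -mulgA -mulgA mulgA; exact: gpredM.
Qed.

Canonical coset_equiv :=
  EquivRel coset_rel coset_rel_refl coset_rel_sym coset_rel_trans.

Definition quotient_group : Type := {eq_quot coset_rel}.

HB.instance Definition _ := Choice.on quotient_group.

Definition coset_pi (x : G) : quotient_group := \pi_({eq_quot coset_rel})%qT x.

Definition coset_repr (a : quotient_group) : G :=
  repr (a : {eq_quot coset_rel}).

Lemma coset_reprK : cancel coset_repr coset_pi.
Proof. exact: reprK. Qed.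

Lemma coset_piP (x y : G) : coset_pi x = coset_pi y <-> x^-1 * y \in N.
Proof. by split=> [/eqmodP|h]; [|exact/eqmodP]. Qed.

Definition quotient_one := coset_pi 1.
Definition quotient_inv (a : quotient_group) := coset_pi (coset_repr a)^-1.
Definition quotient_mul (a b : quotient_group) :=
  coset_pi (coset_repr a * coset_repr b).

Lemma quotient_mulE (x y : G) :
  quotient_mul (coset_pi x) (coset_pi y) = coset_pi (x * y).
Proof.
have /coset_piP hx := coset_reprK (coset_pi x).
have /coset_piP hy := coset_reprK (coset_pi y).
apply/coset_piP.
set x' := coset_repr _ in hx *; set y' := coset_repr _ in hy *.
have -> : (x' * y')^-1 * (x * y) = (x'^-1 * x) ^ y' * (y'^-1 * y).
  by rewrite conjgE invgM -!mulgA mulVKg.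
by apply: gpredM => //; exact: normal_closed.
Qed.

Lemma quotient_invE (x : G) : quotient_inv (coset_pi x) = coset_pi x^-1.
Proof.
have /coset_piP := coset_reprK (coset_pi x).
rewrite /quotient_inv; set x' := coset_repr _ => hx.
apply/coset_piP; rewrite invgK.
have -> : x' * x^-1 = (x'^-1 * x)^-1 ^ x'^-1.
  by rewrite conjgE invgK invgM invgK mulgK.
by apply: normal_closed; exact: gpredVr.
Qed.

Lemma quotient_mulA : associative quotient_mul.
Proof.
move=> a b c; rewrite -(coset_reprK a) -(coset_reprK b) -(coset_reprK c).
by rewrite !quotient_mulE mulgA.
Qed.

Lemma quotient_1mul : left_id quotient_one quotient_mul.
Proof.
by move=> a; rewrite -(coset_reprK a) quotient_mulE mul1g.
Qed.

Lemma quotient_mul1 : right_id quotient_one quotient_mul.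
Proof.
by move=> a; rewrite -(coset_reprK a) quotient_mulE mulg1.
Qed.

Lemma quotient_mulV : left_inverse quotient_one quotient_inv quotient_mul.
Proof.
by move=> a; rewrite -(coset_reprK a) quotient_invE quotient_mulE mulVg.
Qed.

Lemma quotient_Vmul : right_inverse quotient_one quotient_inv quotient_mul.
Proof.
by move=> a; rewrite -(coset_reprK a) quotient_invE quotient_mulE mulgV.
Qed.

HB.instance Definition _ := isGroup.Build quotient_group
  quotient_mulA quotient_1mul quotient_mul1 quotient_mulV quotient_Vmul.
End QuotientGroup.

Definition abelian_group (G : groupType) : Prop := commutative (@mul G).

Definition finite_group (G : groupType) : Prop := finite_set [set: G].

Definition countable_group (G : groupType) : Prop := countable [set: G].

Definition finitely_generated (G : groupType) : Prop :=
  exists s : seq G, forall K : groupClosed G,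
    {subset s <= K} -> forall x : G, x \in K.

Definition by_property (P1 P2 : groupType -> Prop) (G : groupType) : Prop :=
  exists N : normalClosed G, P1 (subgroup_of N) /\ P2 (quotient_group N).

Definition locally (P : groupType -> Prop) (G : groupType) : Prop :=
  forall H : groupClosed G,
    finitely_generated (subgroup_of H) -> P (subgroup_of H).

Definition abelian_by_finite := by_property abelian_group finite_group.

Definition finite_by_abelian := by_property finite_group abelian_group.

Local Open Scope ring_scope.

(* The closed balls are {y | d(x, y) <= r}; the library's [closed_ball] is the
   closure of the open ball, which may be smaller. *)
HB.mixin Record isProperLeftInvariant (R : realType) G
    & Group G & Metric R G := {
  mdist_left_invariant : forall x y z : G,
    mdist (z * x)%g (z * y)%g = mdist x y :> R;
  mdist_proper : forall (x : G) (r : R), compact [set y | mdist x y <= r]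
}.

#[short(type="properGroupType")]
HB.structure Definition ProperGroup (R : realType) :=
  { G of isProperLeftInvariant R G & Group G & Metric R G }.

(* [diam set0] is -oo instead of 0; this is harmless below, where diameters are
   only bounded from above. *)
Definition diam (R : realType) (X : metricType R) (A : set X) : \bar R :=
  ereal_sup [set (mdist p.1 p.2)%:E | p in A `*` A].

(* Finiteness of the supremum is being below +oo: for delta < 0 only the empty
   set is tested. *)
Definition bornologous (R : realType) (X Y : metricType R) (f : X -> Y) :
    Prop :=
  forall delta : R,
    (ereal_sup [set diam (f @` A) | A in [set A | diam A <= delta%:E]] < +oo)%E.

Definition bijectively_coarsely_equivalent (R : realType) (X Y : metricType R) :
    Prop :=
  exists (f : X -> Y) (g : Y -> X) (K : R),
    [/\ bijective f, bijective g, bornologous f & bornologous g] /\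
    (forall x : X, mdist (g (f x)) x <= K) /\
    (forall y : Y, mdist (f (g y)) y <= K).

(* Main.v *)
(* If phi is a bijection from G to an abelian group A such that
   phi(g)^-1 phi(gc) takes finitely many values for each c, and likewise for
   phi^-1, then sup_g d(g, phi^-1 (phi(g) a)) is a proper length function on A
   and phi is a coarse equivalence.  So only such a phi is needed; balls of G
   are finite because G, being countable, is discrete by a Baire argument.

   If N is an abelian normal subgroup of finite index k with transversal s, take
   phi(h s_i) = (h, i) in N x Z_k.

   If G is locally finite-by-abelian, its torsion elements form a normal
   subgroup T with G/T abelian, and T meets every finitely generated subgroup in
   a finite set.  Exhaust G by finitely generated subgroups
   1 = G_0 <= G_1 <= ...  For each n, colour the left cosets of G_n with
   |T \cap G_{n+1} : T \cap G_n| colours so that the cosets of G_n inside one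
   coset of (T \cap G_{n+1}) G_n get every colour once and G_n gets colour 0.
   With u_n(g) the colour of g G_n, take phi(g) = (gT, (u_n(g))_n) in the sum of
   G/T and finite cyclic groups: g^-1 h lies in G_n iff gT, hT differ by the
   image of G_n and u_k(g) = u_k(h) for all k >= n. *)
Require Import Defs.
From HB Require Import structures.
From mathcomp Require Import all_boot all_order all_algebra.
From mathcomp Require Import monoid.
From mathcomp Require Import all_classical all_reals.
From mathcomp Require Import topology ereal.

Set Implicit Arguments.
Unset Strict Implicit.
Unset Printing Implicit Defensive.

Import Order.TTheory GRing.Theory Num.Theory.

Local Open Scope classical_set_scope.
Local Open Scope ring_scope.

(** * Transporting a proper left-invariant metric *)

Record proper_length (R : realType) (A : groupType) (len : A -> R) : Prop :=
  ProperLength {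
    len1 : len 1%g = 0;
    len_eq0 : forall x, len x = 0 -> x = 1%g;
    lenV : forall x, len x^-1%g = len x;
    lenM : forall x y, len (x * y)%g <= len x + len y;
    len_finite : forall r, finite_set [set x | len x <= r] }.

(** A copy of [A] that carries the length and its proof, so that the metric instances below can be
    attached to it. *)
Definition length_group (R : realType) (A : groupType) (len : A -> R)
  (_ : proper_length len) : Type := A.

Section LengthGroup.
Variables (R : realType) (A : groupType) (len : A -> R).
Hypothesis h : proper_length len.

HB.instance Definition _ := Group.copy (length_group h) A.

Definition length_dist (x y : length_group h) : R := len (x^-1 * y)%g.

Lemma length_distxx x : length_dist x x = 0.
Proof. by rewrite /length_dist mulVg (len1 h). Qed.

Lemma length_dist_eq0 x y : length_dist x y = 0 -> x = y.
Proof. by move=> /(len_eq0 h)/mulg1_eq; rewrite invgK. Qed.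

Lemma length_dist_sym x y : length_dist x y = length_dist y x.
Proof. by rewrite /length_dist -(lenV h) invgM invgK. Qed.

Lemma length_dist_triangle y x z :
  length_dist x z <= length_dist x y + length_dist y z.
Proof.
apply: le_trans (lenM h _ _).
by rewrite /length_dist -mulgA mulVKg.
Qed.

HB.instance Definition _ := isMetric.Build R (length_group h)
  length_distxx length_dist_eq0 length_dist_sym length_dist_triangle.

Lemma length_dist_left_invariant (x y z : length_group h) :
  mdist (z * x)%g (z * y)%g = mdist x y :> R.
Proof. by rewrite /mdist/= /length_dist invgM -mulgA mulKg. Qed.

Lemma length_dist_proper (x : length_group h) (r : R) :
  compact [set y | mdist x y <= r].
Proof.
apply: finite_compact.
apply: (sub_finite_set _ (finite_image (fun y => x * y)%g (len_finite h r))).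
by move=> y xy; exists (x^-1 * y)%g => //; rewrite mulVKg.
Qed.

HB.instance Definition _ := isProperLeftInvariant.Build R (length_group h)
  length_dist_left_invariant length_dist_proper.
End LengthGroup.

Lemma dist_bound_bornologous (R : realType) (X Y : metricType R) (f : X -> Y) :
  (forall d : R, exists r : R, forall x y,
    mdist x y <= d -> mdist (f x) (f y) <= r) ->
  bornologous f.
Proof.
move=> fP d; have [r fr] := fP d; apply: (@le_lt_trans _ _ r%:E); last first.
  exact: ltry.
apply: ge_ereal_sup => _ [A Ad <-]; apply: ge_ereal_sup => _ [p [Ap Ap']] <-.
case: Ap Ap' => [x Ax fx] [y Ay fy]; rewrite lee_fin -fx -fy; apply: fr.
rewrite -lee_fin; apply: le_trans Ad; apply: ereal_sup_ubound.
by exists (x, y).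
Qed.

Lemma finite_has_ubound (R : realType) (A : set R) :
  finite_set A -> has_ubound A.
Proof.
move=> /finite_seqP[s ->]; elim: s => [|x s [m ms]].
  by exists 0 => y.
exists (Num.max x m) => y /=; rewrite inE => /orP[/eqP->|/ms ym].
  by rewrite le_max lexx.
by rewrite le_max ym orbT.
Qed.

Section Transport.
Variables (R : realType) (G : properGroupType R) (A : groupType).
Variables (phi : G -> A) (psi : A -> G).
Hypothesis ballG : forall (x : G) (r : R), finite_set [set y | mdist x y <= r].
Hypotheses (phiK : cancel phi psi) (psiK : cancel psi phi).
Hypothesis phi_fin :
  forall c, finite_set (range (fun g => (phi g)^-1 * phi (g * c))%g).
Hypothesis psi_fin :
  forall a, finite_set (range (fun b => (psi b)^-1 * psi (b * a))%g).

Definition displacement (a : A) : set R :=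
  range (fun b => mdist (psi b) (psi (b * a)%g)).

(** The supremum over all [b], rather than the value at [b = 1], makes this length symmetric and
    subadditive. The set is nonempty and, by [psi_fin], bounded, so [sup] is a true supremum. *)
Definition max_displacement (a : A) : R := sup (displacement a).

Lemma displacement_ubound a : has_ubound (displacement a).
Proof.
apply: finite_has_ubound.
apply: (sub_finite_set _ (finite_image (fun x => mdist 1%g x) (psi_fin a))).
move=> _ [b _ <-]; exists ((psi b)^-1 * psi (b * a))%g; first by exists b.
by rewrite -(@mdist_left_invariant _ _ _ _ (psi b)) mulg1 mulVKg.
Qed.

Lemma le_max_displacement a b :
  mdist (psi b) (psi (b * a)%g) <= max_displacement a.
Proof.
apply: sup_upper_bound; last by exists b.
split; last exact: displacement_ubound.
by exists (mdist (psi 1%g) (psi (1 * a)%g)), 1%g.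
Qed.

Lemma max_displacement_le a r :
  (forall b, mdist (psi b) (psi (b * a)%g) <= r) -> max_displacement a <= r.
Proof.
move=> ar; apply: ge_sup; last by move=> _ [b _ <-].
by exists (mdist (psi 1%g) (psi (1 * a)%g)), 1%g.
Qed.

Lemma max_displacement_proper : proper_length max_displacement.
Proof.
have ge0 a : 0 <= max_displacement a.
  exact: le_trans (mdist_ge0 _ _) (le_max_displacement a 1%g).
have leV a : max_displacement a^-1%g <= max_displacement a.
  apply: max_displacement_le => b; rewrite metric_sym.
  by have := le_max_displacement a (b * a^-1)%g; rewrite mulgVK.
split.
- apply/eqP; rewrite eq_le ge0 andbT; apply: max_displacement_le => b.
  by rewrite mulg1 mdistxx.
- move=> a a0; have := le_max_displacement a 1%g; rewrite a0 mul1g => le0.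
  have /mdist_positivity/(can_inj psiK)->// : mdist (psi 1%g) (psi a) = 0.
  by apply/eqP; rewrite eq_le le0 mdist_ge0.
- by move=> a; apply/eqP; rewrite eq_le leV -{1}(invgK a) leV.
- move=> a b; apply: max_displacement_le => c.
  apply: le_trans (metric_triangle _ (psi (c * a)%g) _) _.
  by rewrite mulgA lerD ?le_max_displacement.
(* The case [b = 1] puts [psi a] in the finite ball of radius [r] about [psi 1]. *)
- move=> r; apply: sub_finite_set (finite_image phi (ballG (psi 1%g) r)).
  move=> a /= ar; exists (psi a) => //.
  by have := le_max_displacement a 1%g; rewrite mul1g => /le_trans; apply.
Qed.

(** Points at distance at most [d] differ by an element of a finite ball, so [phi_fin] leaves
    finitely many quotients of their images, whose lengths are bounded. By construction of the
    length, [psi] does not increase distances. *)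
Lemma transport_bijectively_coarsely_equivalent :
  bijectively_coarsely_equivalent G (length_group max_displacement_proper).
Proof.
exists phi, psi, 0; split; last by split=> x; rewrite ?phiK ?psiK mdistxx.
split; [by exists psi | by exists phi | |].
- apply: dist_bound_bornologous => d.
  have fin : finite_set (\bigcup_(c in [set c : G | mdist 1%g c <= d])
      range (fun g => (phi g)^-1 * phi (g * c))%g).
    by apply: bigcup_finite => // c _; exact: phi_fin.
  have [r rP] := finite_has_ubound (finite_image max_displacement fin).
  exists r => x y xy; apply: rP; exists ((phi x)^-1 * phi y)%g => //.
  exists (x^-1 * y)%g; last by exists x => //; rewrite mulVKg.
  by rewrite /= -(@mdist_left_invariant _ _ _ _ x) mulg1 mulVKg.
- apply: dist_bound_bornologous => d; exists d => a b; apply: le_trans.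
  by have := le_max_displacement (a^-1 * b)%g a; rewrite mulVKg.
Qed.
End Transport.

(** * Countable proper groups are discrete *)

Lemma cluster_sequence (R : realType) (X : metricType R) (K : set X)
    (x : nat -> X) :
  compact K -> (forall n, K (x n)) ->
  exists2 p, K p & forall e : R, 0 < e -> forall n,
    exists2 m, (n <= m)%N & mdist p (x m) < e.
Proof.
move=> cK Kx.
have [|p [Kp clp]] := cK (x @ \oo) _; first by exists 0%N => // n _; exact: Kx.
exists p => // e e0 n.
have /clp/(_ (nbhsx_ballx p e e0))[_ [[m nm <-] pm]] :
  (x @ \oo) (x @` [set m | (n <= m)%N]).
  by exists n => // m nm; exists m.
by exists m => //; move: pm; rewrite ballEmdist.
Qed.

Section ProperBalls.
Variables (R : realType) (G : properGroupType R).

Lemma mdist1g (x y : G) : mdist x y = mdist 1%g (x^-1 * y)%g :> R.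
Proof. by rewrite -(@mdist_left_invariant _ _ 1%g _ x) mulg1 mulVKg. Qed.

(** An infinite ball contains an injective sequence, which clusters by compactness; two terms within
    [e / 2] of the cluster point differ by an element closer than [e] to 1. *)
Lemma discrete_closed_ball_finite (x : G) (r e : R) :
  0 < e -> (forall y : G, mdist 1%g y < e -> y = 1%g) ->
  finite_set [set y | mdist x y <= r].
Proof.
move=> e0 discr; apply: contrapT => /infiniteP/card_leP[f].
pose y n : G := val (f (to_setT n)).
have y_inj : injective y.
  move=> i j /val_inj/(@inj _ _ _ f)-/(_ (in_setT _) (in_setT _)).
  exact: (congr1 val).
have [|p _ clp] := cluster_sequence (x := y) (mdist_proper x r).
  by move=> n; exact: (set_valP (f (to_setT n))).
have e20 : 0 < e / 2 by rewrite divr_gt0.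
have [m _ pm] := clp _ e20 0%N.
have [n mn pn] := clp _ e20 m.+1.
have /y_inj mnE : y m = y n.
  apply: (mulgI (y m)^-1%g); rewrite mulVg; symmetry; apply: discr.
  rewrite -mdist1g (le_lt_trans (metric_triangle _ p _))//.
  by rewrite metric_sym [ltRHS]splitr ltrD.
by rewrite mnE ltnn in mn.
Qed.

Lemma shrink_ball (z x : G) (r : R) :
  (forall e : R, 0 < e -> exists2 y : G, mdist 1%g y < e & y <> 1%g) ->
  0 < r -> exists x' r', [/\ 0 < r', ~ (mdist x' z <= r') &
    forall y, mdist x' y <= r' -> mdist x y <= r].
Proof.
move=> dense r0; have r20 : 0 < r / 2 by rewrite divr_gt0.
(* If the centre is [z] itself, it is moved by less than [r / 2]; the other half of [r] is left for
   the new radius. *)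
have [x' xx' x'z] : exists2 x', mdist x x' < r / 2 & x' <> z.
  have [<-|xz] := pselect (x = z); last by exists x => //; rewrite mdistxx.
  have [y y1 yN1] := dense _ r20; exists (x * y)%g.
    by rewrite mdist1g mulKg.
  by move=> xyx; apply: yN1; apply: (mulgI x); rewrite xyx mulg1.
have x'z0 : 0 < mdist x' z by rewrite mdist_gt0; apply/eqP.
exists x', (Num.min (r / 2) (mdist x' z / 2)); split.
- by rewrite lt_min r20 divr_gt0.
- apply/negP; rewrite -ltNge; apply: (@le_lt_trans _ _ (mdist x' z / 2)).
    by rewrite ge_min lexx orbT.
  by rewrite ltr_pdivrMr// ltr_pMr// ltr1n.
- move=> y; rewrite le_min => /andP[x'y _].
  by rewrite (le_trans (metric_triangle _ x' _))// [leRHS]splitr lerD// ltW.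
Qed.

(* Baire: otherwise closed balls can be nested so that the n-th one avoids the
   n-th point, and compactness gives a point of G that is not enumerated. *)
Lemma countable_proper_discrete : countable_group G ->
  exists2 e : R, 0 < e & forall y : G, mdist 1%g y < e -> y = 1%g.
Proof.
move=> /countable_injP[c c_inj]; apply: contrapT => ndiscr.
have dense (e : R) : 0 < e -> exists2 y : G, mdist 1%g y < e & y <> 1%g.
  move=> e0; apply: contrapT => ney; apply: ndiscr; exists e => // y ye.
  by apply: contrapT => y1; apply: ney; exists y.
(* Positivity of the radius is a premise under the existential, so that [choice] yields a total
   function; [s0] restores it by induction. *)
have step (s : nat * (G * R)) : exists t : G * R, 0 < s.2.2 -> [/\ 0 < t.2,
    forall y, mdist t.1 y <= t.2 -> c y <> s.1 &
    forall y, mdist t.1 y <= t.2 -> mdist s.2.1 y <= s.2.2].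
  case: s => n [x r] /=.
  have [r0|] := pselect (0 < r); last by exists (x, r).
  have [[z czn]|nz] := pselect (exists z, c z = n); last first.
    by exists (x, r) => _; split=> // y _ yn; apply: nz; exists y.
  have [x' [r' [r'0 x'z x'r']]] := shrink_ball z x dense r0.
  exists (x', r') => _; split=> //= y yr' cyn; apply: x'z.
  by rewrite (_ : z = y)//; apply: c_inj; rewrite ?in_setT// czn cyn.
have [next nextP] := choice step.
pose s := fix s n := if n is m.+1 then next (m, s m) else (1%g : G, 1 : R).
have s0 n : 0 < (s n).2.
  by elim: n => [|n IHn] /=; rewrite ?ltr01//; have [] := nextP (n, s n) IHn.
have nested n k y : mdist (s (k + n)%N).1 y <= (s (k + n)%N).2 ->
    mdist (s n).1 y <= (s n).2.
  elim: k => // k IHk; rewrite addSn => yk; apply: IHk.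
  by have [_ _] := nextP ((k + n)%N, s (k + n)%N) (s0 _); apply.
have sn n k : mdist (s n).1 (s (k + n)%N).1 <= (s n).2.
  by apply: (nested n k); rewrite mdistxx ltW.
have [|p _ clp] := cluster_sequence (x := fst \o s) (mdist_proper 1%g 1).
  by move=> n /=; have := sn 0%N n; rewrite addn0.
have ps n : mdist (s n).1 p <= (s n).2.
  apply/ler_addgt0Pl => e e0; have [m nm pm] := clp _ e0 n.
  apply: le_trans (metric_triangle _ (s m).1 _) _; rewrite addrC lerD//.
    by rewrite metric_sym ltW.
  by have := sn n (m - n)%N; rewrite subnK.
have [_ avoid _] := nextP (c p, s (c p)) (s0 _).
exact: avoid (ps (c p).+1) erefl.
Qed.

Lemma proper_ball_finite (x : G) (r : R) : countable_group G ->
  finite_set [set y | mdist x y <= r].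
Proof.
move=> /countable_proper_discrete[e e0 discr].
exact: discrete_closed_ball_finite discr.
Qed.

End ProperBalls.

Local Close Scope ring_scope.
Local Open Scope group_scope.

(** * Abelian-by-finite groups *)

(** The label is the position in a duplicate-free list of [A] that starts with [x0]. Labels live in
    ['I_k.+1] to form a cyclic group, with [x0] at the neutral element. *)
Lemma finite_set_label (T : eqType) (A : set T) (x0 : T) :
  finite_set A -> A x0 ->
  exists k (f : T -> 'I_k.+1), [/\ f x0 = ord0,
    forall x y, A x -> A y -> f x = f y -> x = y &
    forall i, exists2 x, A x & f x = i].
Proof.
move=> /finite_seqP[s ->] /= x0s; pose t := rem x0 (undup s).
have ust : perm_eq (undup s) (x0 :: t) by rewrite perm_to_rem ?mem_undup.
have ut : uniq (x0 :: t) by rewrite -(perm_uniq ust) undup_uniq.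
have memt x : (x \in s) = (x \in x0 :: t) by rewrite -(perm_mem ust) mem_undup.
exists (size t), (fun x => inord (index x (x0 :: t))); split.
- by rewrite /= eqxx; apply: val_inj; rewrite /= inordK.
- move=> x y; rewrite !memt => xs ys /(congr1 (@nat_of_ord _)).
  have lt z : z \in x0 :: t -> (index z (x0 :: t) < (size t).+1)%N.
    by rewrite -index_mem.
  rewrite !inordK ?lt // => e.
  by rewrite -(nth_index x0 xs) e nth_index.
- move=> i; exists (nth x0 (x0 :: t) i); first by rewrite memt mem_nth.
  by rewrite index_uniq // inord_val.
Qed.

Definition coarsely_abelian (R : realType) (G : properGroupType R) : Prop :=
  exists A : properGroupType R,
    [/\ countable_group A, abelian_group A &
        bijectively_coarsely_equivalent G A].

Lemma coarsely_abelian_transport (R : realType) (G : properGroupType R)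
    (A : groupType) (phi : G -> A) (psi : A -> G) :
  countable_group G -> abelian_group A ->
  cancel phi psi -> cancel psi phi ->
  (forall c, finite_set (range (fun g => (phi g)^-1 * phi (g * c)))) ->
  (forall a, finite_set (range (fun b => (psi b)^-1 * psi (b * a)))) ->
  coarsely_abelian G.
Proof.
move=> cG aA phiK psiK phi_fin psi_fin.
have ballG x r := @proper_ball_finite R G x r cG.
exists (length_group (max_displacement_proper ballG psiK psi_fin)); split=> //.
- rewrite /countable_group (_ : [set: _] = range phi).
    exact: sub_countable (card_image_le _ _) cG.
  by apply/seteqP; split=> // a _; exists (psi a).
- exact: transport_bijectively_coarsely_equivalent.
Qed.

Lemma abelian_by_finite_coarsely_abelian (R : realType)
    (G : properGroupType R) :
  countable_group G -> abelian_by_finite G ->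
  coarsely_abelian G.
Proof.
move=> cG [N [aN fN]].
have [k [f [_ finj fsurj]]] := finite_set_label fN (I : setT (coset_pi N 1)).
have /choice[j jP] i : exists a, f a = i by have [a _ <-] := fsurj i; exists a.
have jK : cancel f j by move=> a; apply: finj => //; rewrite jP.
pose s i := coset_repr (j i).
have sP g : g * (s (f (coset_pi N g)))^-1 \in N.
  rewrite /s jK; set c := coset_pi N g.
  have /coset_piP/(normal_closed (coset_repr c)^-1) := coset_reprK c.
  by rewrite conjgE invgK mulgA mulVKg.
pose phi g : subgroup_of N * 'I_k.+1 :=
  (Sub (g * (s (f (coset_pi N g)))^-1) (sP g), f (coset_pi N g)).
pose psi (b : subgroup_of N * 'I_k.+1) := val b.1 * s b.2.
have phiK : cancel phi psi by move=> g; rewrite /psi /= mulgVK.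
have psi_pi b : coset_pi N (psi b) = j b.2.
  rewrite -(coset_reprK (j b.2)); apply/coset_piP.
  have hV : (val b.1)^-1 \in N by rewrite gpredV; exact: valP.
  have := normal_closed (s b.2) _ hV.
  by rewrite conjgE /psi invgM mulgA.
have psiK : cancel psi phi.
  move=> b; rewrite /phi; case: b (psi_pi b) => [h i] /= bE; congr (_, _).
    by apply: val_inj; rewrite SubK bE jP /psi mulgK.
  by rewrite bE jP.
apply: (coarsely_abelian_transport cG _ phiK psiK) => [|c|a].
- by move=> [x i] [y i']; congr (_, _); [exact: aN | exact: Zp_mulgC].
(* With [p] the labels of [g] and [g * c], the element [g] cancels from the [N]-component. Pairs for
   which the product lies outside [N] arise from no [g] and get the default 1. *)
- pose d (p : 'I_k.+1 * 'I_k.+1) : subgroup_of N * 'I_k.+1 :=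
    (insubd 1 (s p.1 * c * (s p.2)^-1), p.1^-1 * p.2).
  apply: sub_finite_set (@finite_image _ _ setT d finite_finset) => _ [g _ <-].
  exists (f (coset_pi N g), f (coset_pi N (g * c))) => //.
  congr (_, _).
  apply: etrans (valKd (1 : subgroup_of N) _); congr insubd.
  by rewrite valM gmulfV !SubK invgM invgK -!mulgA mulKg.
(* The [N]-component [h] cancels, so the quotient depends on the label [i] only. *)
- pose d i : G := (s i)^-1 * val a.1 * s (i * a.2).
  apply: sub_finite_set (@finite_image _ _ setT d finite_finset).
  move=> _ [[h i] _ <-].
  exists i => //; have -> : psi ((h, i) * a) = val h * val a.1 * s (i * a.2).
    by rewrite -valM.
  by rewrite /psi/= invgM /d -!mulgA mulKg.
Qed.

(** * Torsion in finite-by-abelian groups *)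

Definition group_pred (G : groupType) (S : {pred G}) (_ : group_closed S) :
  {pred G} := S.

Section GroupPred.
Variables (G : groupType) (S : {pred G}) (h : group_closed S).
HB.instance Definition _ :=
  isMulClosed.Build G (group_pred h) (group_closedM h).
HB.instance Definition _ := isMul1Closed.Build G (group_pred h) h.1.
HB.instance Definition _ :=
  isInvClosed.Build G (group_pred h) (group_closedV h).

Definition group_closed_of : groupClosed G :=
  [the groupClosed G of group_pred h].
End GroupPred.

Lemma trivial_closed (G : groupType) : group_closed (pred1 (1 : G)).
Proof. by split=> [|x y]; rewrite !inE // => /eqP-> /eqP->; rewrite divgg. Qed.

Definition torsion (G : groupType) (x : G) : Prop :=
  exists2 n, (0 < n)%N & x ^+ n = 1.

Lemma torsionV (G : groupType) (x : G) : torsion x -> torsion x^-1.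
Proof. by move=> [n n0 xn]; exists n; rewrite // expVgn xn invg1. Qed.

Lemma torsionM_commute (G : groupType) (x y : G) :
  commute x y -> torsion x -> torsion y -> torsion (x * y).
Proof.
move=> xy [m m0 xm] [n n0 yn]; exists (m * n)%N; first by rewrite muln_gt0 m0.
by rewrite expgMn // expgnA xm expg1n mulnC expgnA yn expg1n mulg1.
Qed.

Section AbelianTorsion.
Variables (G : groupType) (abG : abelian_group G).

(** The subgroup generated by [M] and [a]; powers of [a] on both sides replace an integer
    exponent. *)
Definition adjoin_pred (M : groupClosed G) (a : G) : {pred G} :=
  fun x => `[< exists2 m, m \in M & exists i j, x * a ^+ i = m * a ^+ j >].

Lemma abelian_interchange : interchange (@mul G) (@mul G).
Proof.
move=> x y z t; rewrite -!mulgA; congr (_ * _).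
by rewrite mulgA (abG y z) -mulgA.
Qed.

Lemma adjoin_closed M a : group_closed (adjoin_pred M a).
Proof.
split; first by apply/asboolP; exists 1; [exact: gpred1 | exists 0%N, 0%N].
move=> x y /asboolP[m mM [i [j xij]]] /asboolP[n nM [k [l ykl]]].
apply/asboolP; exists (m / n); first exact: gpredF.
exists (i + l)%N, (j + k)%N; rewrite !expgnDr abelian_interchange xij.
have -> : y^-1 * a ^+ l = n^-1 * a ^+ k.
  by rewrite -[a ^+ l](mulKg n) -ykl (abG n^-1) mulgA mulKg abG.
by rewrite abelian_interchange.
Qed.

Lemma expg_relation (M : groupClosed G) a w s t : w \in M ->
  a ^+ s = w * a ^+ t -> s = t \/ exists2 p, (0 < p)%N & a ^+ p \in M.
Proof.
move=> wM; have [st|ts|->] := ltngtP s t; last by left.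
- rewrite -{1}(subnK (ltnW st)) expgnDr => E; right; exists (t - s)%N.
    by rewrite subn_gt0.
  have /mulg1_eq <- : w * a ^+ (t - s) = 1.
    by apply: (mulIg (a ^+ s)); rewrite mul1g -mulgA.
  by rewrite gpredV.
- rewrite -{1}(subnK (ltnW ts)) expgnDr => /mulIg atsE.
  by right; exists (s - t)%N; rewrite ?subn_gt0 ?atsE.
Qed.

(** If no positive power of [a] is in [M], adjoining [a] creates no torsion. If [a ^+ p] is in [M],
    every element has the form [m * a ^+ k] with [k < p], and for fixed [k] two torsion elements
    differ by a torsion element of [M]. *)
Lemma adjoin_torsion_finite (M : groupClosed G) a :
  finite_set [set x | x \in M /\ torsion x] ->
  finite_set [set x | x \in adjoin_pred M a /\ torsion x].
Proof.
move=> finM.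
have [[p p0 apM]|aM] := pselect (exists2 p, (0 < p)%N & a ^+ p \in M);
  last first.
  apply: sub_finite_set finM => x [/asboolP[m mM [i [j xij]]] tx]; split=> //.
  have [n n0 xn] := tx.
  (* The power [n] kills [x], and [expg_relation] then forces [i * n = j * n]. *)
  have /(congr1 (fun y => y ^+ n)) := xij.
  rewrite (expgMn _ (abG _ _)) (expgMn _ (abG _ _)) xn mul1g -!expgnA.
  move=> /expg_relation-/(_ M (gpredXn n mM))[/eqP|//].
  by rewrite eqn_pmul2r // => /eqP ij; move: xij; rewrite ij => /mulIg ->.
pose T k := [set x | (exists2 m, m \in M & x = m * a ^+ k) /\ torsion x].
have finT k : finite_set (T k).
  have [[y [[m mM yE] ty]]|noT] := pselect (exists y, T k y); last first.
    by apply: sub_finite_set (@finite_set0 G) => x Tx; apply: noT; exists x.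
  apply: sub_finite_set (finite_image (fun x => y * x) finM).
  move=> x [[n nM xE] tx]; exists (y^-1 * x); last by rewrite mulVKg.
  split; last exact: torsionM_commute (abG _ _) (torsionV ty) tx.
  rewrite xE yE (abG m) (abG n) invgM -mulgA mulKg.
  by rewrite gpredM // gpredV.
apply: sub_finite_set (bigcup_finite (finite_II p) (fun k _ => finT k)).
move=> x [/asboolP[m mM [i [j xij]]] tx].
(* The exponent [j - i] modulo [p], with [i * p.-1] in place of [- i]. *)
exists ((j + i * p.-1) %% p)%N; first by rewrite /= ltn_pmod.
split=> //; set k := (_ %% p)%N; set q := ((j + i * p.-1) %/ p)%N.
exists (m * (a ^+ p) ^+ q / (a ^+ p) ^+ i).
  by apply: gpredF; [apply: gpredM => //; exact: gpredXn | exact: gpredXn].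
have jE : a ^+ (j + i * p.-1) = (a ^+ p) ^+ q * a ^+ k.
  by rewrite [(j + _)%N](divn_eq _ p) expgnDr [(_ * p)%N]mulnC expgnA.
apply: (mulIg (a ^+ (i * p))).
have {1}-> : (i * p = i + i * p.-1)%N by rewrite -mulnS prednK.
rewrite expgnDr mulgA xij -mulgA -expgnDr jE [(i * p)%N]mulnC expgnA.
by rewrite -[RHS]mulgA (abG (a ^+ k)) !mulgA mulgVK.
Qed.

Lemma torsion_finite_abelian : finitely_generated G ->
  finite_set [set x : G | torsion x].
Proof.
move=> [s genG].
have [M sM finM] : exists2 M : groupClosed G, {subset s <= M} &
    finite_set [set x | x \in M /\ torsion x].
  elim: s {genG} => [|a s [M sM finM]].
    exists (group_closed_of (trivial_closed G)) => //.
    by apply: sub_finite_set (finite_set1 (1 : G)) => x [/eqP].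
  exists (group_closed_of (adjoin_closed M a)); last first.
    exact: adjoin_torsion_finite.
  move=> x; rewrite inE => /orP[/eqP-> | /sM xM]; apply/asboolP.
    by exists 1; [exact: gpred1 | exists 0%N, 1%N; rewrite mulg1 mul1g].
  by exists x => //; exists 0%N, 0%N.
by apply: sub_finite_set finM => x tx; split=> //; exact: genG.
Qed.

End AbelianTorsion.

Section CosetMorphism.
Variables (G : groupType) (N : normalClosed G).

Lemma coset_piF : {morph coset_pi N : x y / x / y}.
Proof.
move=> x y; rewrite -[LHS]quotient_mulE.
by congr (_ * _); rewrite -[LHS]quotient_invE.
Qed.

HB.instance Definition _ := isGroupMorphism.Build _ _ (coset_pi N) coset_piF.

Lemma coset_pi_eq1 x : coset_pi N x = 1 <-> x \in N.
Proof.
have /= <- : coset_pi N 1 = 1 by exact: gmulf1.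
split=> [/esym/coset_piP|xN]; first by rewrite invg1 mul1g.
by apply/esym/coset_piP; rewrite invg1 mul1g.
Qed.

Lemma quotient_finitely_generated :
  finitely_generated G -> finitely_generated (quotient_group N).
Proof.
move=> [s genG]; exists (map (coset_pi N) s) => K sK a.
have preim_closed : group_closed [pred x | coset_pi N x \in K].
  split=> [|x y]; rewrite !inE; first by rewrite gmulf1 gpred1.
  by move=> xK yK; rewrite gmulfF gpredF.
rewrite -(coset_reprK a).
apply: (genG (group_closed_of preim_closed)) => x xs.
by apply: sK; exact: map_f.
Qed.

End CosetMorphism.

Lemma finite_range_repeat (T : Type) (f : nat -> T) :
  finite_set (range f) -> exists i j, (i < j)%N /\ f i = f j.
Proof.
move=> fin; apply: contrapT => nf; apply: infinite_nat.
rewrite -(@eq_finite_set _ _ (range f)) //; apply: inj_card_eq.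
move=> i j _ _ fij; apply: contrapT => /eqP; rewrite neq_ltn => /orP[] lt.
  by apply: nf; exists i, j.
by apply: nf; exists j, i.
Qed.

Lemma subgroup_finite (G : groupType) (N : groupClosed G) :
  finite_group (subgroup_of N) <-> finite_set [set x | x \in N].
Proof.
split=> [fin|fin].
  apply: sub_finite_set (finite_image val fin) => x xN.
  by exists (Sub x xN : subgroup_of N).
apply: sub_finite_set (finite_image (insubd (1 : subgroup_of N)) fin).
by move=> x _; exists (val x); [exact: (valP x) | exact: valKd].
Qed.

Lemma finite_torsion (G : groupType) (N : groupClosed G) x :
  finite_group (subgroup_of N) -> x \in N -> torsion x.
Proof.
move=> /subgroup_finite fin xN.
have [|i [j [ij xij]]] := @finite_range_repeat _ (fun n => x ^+ n).
  by apply: sub_finite_set fin => _ [n _ <-]; exact: gpredXn.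
exists (j - i)%N; first by rewrite subn_gt0.
by rewrite expgnFr ?(ltnW ij) // xij divgg.
Qed.

Section FiniteByAbelian.
Variables (G : groupType) (fabG : finite_by_abelian G).

(** Torsion maps into the torsion of the finitely generated abelian quotient, which is finite, and
    each fibre is a coset of a finite subgroup. *)
Lemma finite_by_abelian_torsion_finite :
  finitely_generated G -> finite_set [set x : G | torsion x].
Proof.
move: fabG => [N [finN abN]] fgG.
have finQ := torsion_finite_abelian abN (quotient_finitely_generated N fgG).
move/subgroup_finite in finN.
apply: sub_finite_set (bigcup_finite finQ
  (fun a _ => finite_image (fun x => coset_repr a * x) finN)).
move=> x [n n0 xn]; exists (coset_pi N x).
  by exists n => //; rewrite -gmulfXn xn gmulf1.
exists ((coset_repr (coset_pi N x))^-1 * x); last by rewrite mulVKg.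
by apply/coset_piP; rewrite coset_reprK.
Qed.

(** The power [m * n] kills [x * y] in the abelian quotient, so [(x * y) ^+ (m * n)] lies in a
    finite subgroup. *)
Lemma finite_by_abelian_torsionM (x y : G) :
  torsion x -> torsion y -> torsion (x * y).
Proof.
move: fabG => [N [finN abN]] [m m0 xm] [n n0 yn].
have [|k k0] := @finite_torsion _ _ ((x * y) ^+ (m * n)) finN.
  apply/coset_pi_eq1; rewrite gmulfXn gmulfM expgMn; last exact: abN.
  rewrite expgnA -gmulfXn xm gmulf1 expg1n mul1g mulnC.
  by rewrite expgnA -gmulfXn yn gmulf1 expg1n.
by rewrite -expgnA; exists (m * n * k)%N; rewrite // !muln_gt0 m0 n0 k0.
Qed.

Lemma finite_by_abelian_torsion_commg (x y : G) : torsion [~ x, y].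
Proof.
move: fabG => [N [finN abN]]; apply: finite_torsion finN _.
apply/coset_pi_eq1; rewrite gmulfR; apply/eqP/commgP; exact: abN.
Qed.

End FiniteByAbelian.

(** * Direct sums and coset colourings *)

Section DirectSum.
Variable X : nat -> groupType.

Record direct_sum := DirectSum {
  component :> forall n, X n;
  component_eventually1 : exists N, forall n, (N <= n)%N -> component n = 1
}.

HB.instance Definition _ := gen_eqMixin direct_sum.
HB.instance Definition _ := gen_choiceMixin direct_sum.

Lemma direct_sum_ext (e f : direct_sum) : (forall n, e n = f n) -> e = f.
Proof.
case: e f => [e eP] [f fP] /= ef.
have E : e = f by apply: functional_extensionality_dep.
by move: fP; rewrite -E => fP; congr DirectSum; exact: Prop_irrelevance.
Qed.

Lemma mul_eventually1 (e f : direct_sum) :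
  exists N, forall n, (N <= n)%N -> e n * f n = 1.
Proof.
have [M eM] := component_eventually1 e; have [N fN] := component_eventually1 f.
exists (maxn M N) => n; rewrite geq_max => /andP[Mn Nn].
by rewrite eM // fN // mulg1.
Qed.

Lemma inv_eventually1 (e : direct_sum) :
  exists N, forall n, (N <= n)%N -> (e n)^-1 = 1.
Proof.
have [N eN] := component_eventually1 e.
by exists N => n /eN ->; rewrite invg1.
Qed.

Lemma one_eventually1 : exists N, forall n, (N <= n)%N -> 1 = 1 :> X n.
Proof. by exists 0%N. Qed.

Definition direct_sum_one := DirectSum one_eventually1.
Definition direct_sum_mul e f := DirectSum (mul_eventually1 e f).
Definition direct_sum_inv e := DirectSum (inv_eventually1 e).

Lemma direct_sum_mulA : associative direct_sum_mul.
Proof. by move=> e f g; apply: direct_sum_ext => n; exact: mulgA. Qed.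

Lemma direct_sum_1mul : left_id direct_sum_one direct_sum_mul.
Proof. by move=> e; apply: direct_sum_ext => n; exact: mul1g. Qed.

Lemma direct_sum_mul1 : right_id direct_sum_one direct_sum_mul.
Proof. by move=> e; apply: direct_sum_ext => n; exact: mulg1. Qed.

Lemma direct_sum_mulV :
  left_inverse direct_sum_one direct_sum_inv direct_sum_mul.
Proof. by move=> e; apply: direct_sum_ext => n; exact: mulVg. Qed.

Lemma direct_sum_Vmul :
  right_inverse direct_sum_one direct_sum_inv direct_sum_mul.
Proof. by move=> e; apply: direct_sum_ext => n; exact: mulgV. Qed.

HB.instance Definition _ := isGroup.Build direct_sum
  direct_sum_mulA direct_sum_1mul direct_sum_mul1
  direct_sum_mulV direct_sum_Vmul.
End DirectSum.

Lemma cyclic_sum_finite (m : nat -> nat) N :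
  finite_set [set e : direct_sum (fun n => 'I_(m n).+1) |
    forall n, (N <= n)%N -> e n = 1].
Proof.
set E := [set _ | _].
pose F (e : direct_sum (fun n => 'I_(m n).+1)) :=
  [ffun i : 'I_N => e i] : {dffun forall i : 'I_N, 'I_(m i).+1}.
rewrite -(@eq_finite_set _ _ (F @` E)); first exact: finite_finset.
apply: inj_card_eq => e f /set_mem eE /set_mem fE.
move=> /ffunP EF; apply: direct_sum_ext => n.
have [/[dup]/eE-> /fE->//|nN] := leqP N n.
by have := EF (Ordinal nN); rewrite !ffunE.
Qed.

Lemma left_transversal (G : groupType) (K : groupClosed G) :
  exists t : G -> G, [/\ forall x, x \in K -> t x = 1,
    forall x, x^-1 * t x \in K & forall x y, x^-1 * y \in K -> t x = t y].
Proof.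
(* [xget] sees only the coset as a set, hence is constant on it; [K] is treated apart to get the
   representative 1. *)
pose t x := if x \in K then 1 else xget 1 [set y | x^-1 * y \in K].
exists t; split=> [x xK | x | x y xyK]; first by rewrite /t xK.
  rewrite /t; case: ifPn => xK; first by rewrite mulg1 gpredV.
  by case: xgetP => [y _ //|/(_ x)[]]; rewrite /= mulVg gpred1.
have memK : (x \in K) = (y \in K).
  apply/idP/idP => xK; first by rewrite -(mulVKg x y) gpredM.
  by rewrite -(gpredV K) -(mulgK y x^-1) gpredM // gpredV.
rewrite /t memK; case: ifP => // _; congr xget; apply/seteqP; split=> z /= zK.
  by rewrite -(mulVKg x z) mulgA gpredM // -(gpredV K) invgM invgK.
by rewrite -(mulVKg y z) mulgA gpredM.
Qed.

(** As [D] meets every coset of [K] in [L], these are finitely many. They are labelled once, and the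
    labelling is translated to each coset of [L] by its representative [r x]. *)
Lemma coset_coloring (G : groupType) (K L : groupClosed G) (D : set G) :
  {subset K <= L} -> finite_set D -> (forall d, D d -> d \in L) ->
  (forall l, l \in L -> exists2 d, D d & d^-1 * l \in K) ->
  exists k (u : G -> 'I_k.+1), [/\ forall x, x \in K -> u x = 1,
    forall x y, x^-1 * y \in K -> u x = u y,
    forall x y, x^-1 * y \in L -> u x = u y -> x^-1 * y \in K &
    forall x i, exists2 d, D d & u (x * d) = i].
Proof.
move=> KL finD DL DK.
have [t [t1 tK tE]] := left_transversal K.
have [r [r1 rL rE]] := left_transversal L.
have finA : finite_set [set t l | l in [set l | l \in L]].
  apply: sub_finite_set (finite_image t finD) => _ [l lL <-].
  by have [d Dd dl] := DK _ lL; exists d => //; exact: tE.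
have A1 : [set t l | l in [set l | l \in L]] (1 : G).
  by exists 1; [exact: gpred1 | exact/t1/gpred1].
have [k [f [f1 finj fsurj]]] := finite_set_label finA A1.
have rxL x : (r x)^-1 * x \in L by rewrite -(gpredV L) invgM invgK.
have uK x y : x^-1 * y \in K -> f (t ((r x)^-1 * x)) = f (t ((r y)^-1 * y)).
  move=> xyK; rewrite (rE x y) ?KL //; congr f; apply: tE.
  by rewrite invgM invgK -mulgA mulVKg.
exists k, (fun x => f (t ((r x)^-1 * x))); split=> //.
- move=> x xK; rewrite r1 ?KL // invg1 mul1g t1 //.
- move=> x y xyL; rewrite (rE x y) // => /finj E.
  have {}E : t ((r y)^-1 * x) = t ((r y)^-1 * y).
    by apply: E; [exists ((r y)^-1 * x) => //=; rewrite -(rE x y)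
                 |exists ((r y)^-1 * y) => /=].
  have := gpredF (tK ((r y)^-1 * x)) (tK ((r y)^-1 * y)).
  by rewrite E !invgM !invgK !mulgA !mulgK.
(* Here [l] is a point of [L] whose coset has label [i], and [d] is chosen so that [x * d] and
   [r x * l] lie in the same coset of [K]. *)
- move=> x i; have [_ [l lL <-] fi] := fsurj i.
  have [|d Dd dK] := DK (x^-1 * r x * l); first exact: gpredM.
  exists d => //; rewrite (uK _ (r x * l)); last first.
    by rewrite invgM -mulgA [x^-1 * _]mulgA.
  rewrite -(rE x) ?mulKg //.
  by rewrite mulgA gpredM.
Qed.

(** * Exhaustions by finitely generated subgroups *)

Section Generated.
Variables (G : groupType) (A : set G).

Definition generated_pred : {pred G} := fun x =>
  `[< forall K : groupClosed G, (forall y, A y -> y \in K) -> x \in K >].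

Lemma generated_closed : group_closed generated_pred.
Proof.
split; first by apply/asboolP => K _; exact: gpred1.
move=> x y /asboolP xA /asboolP yA; apply/asboolP => K KA.
by apply: gpredF; [exact: xA | exact: yA].
Qed.

Definition generated : groupClosed G := group_closed_of generated_closed.

Lemma sub_generated x : A x -> x \in generated.
Proof. by move=> Ax; apply/asboolP => K; apply. Qed.

Lemma generated_min (K : groupClosed G) :
  (forall y, A y -> y \in K) -> {subset generated <= K}.
Proof. by move=> AK x /asboolP; apply. Qed.

(** A subgroup of the subgroup type is pushed forward to [G] along [val], where minimality of
    [generated] applies. *)
Lemma generated_finitely_generated :
  finite_set A -> finitely_generated (subgroup_of generated).
Proof.
move=> /finite_seqP[s As]; exists (map (insubd 1) s) => K sK x.
have val_closed : group_closed
    (fun y => `[< exists2 z : subgroup_of generated, val z = y & z \in K >]).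
  split; first by apply/asboolP; exists 1; [exact: gmulf1 | exact: gpred1].
  move=> y z /asboolP[y' <- yK] /asboolP[z' <- zK]; apply/asboolP.
  by exists (y' / z'); [exact: gmulfF | exact: gpredF].
have genK : {subset generated <= group_closed_of val_closed}.
  apply: generated_min => y Ay; apply/asboolP; exists (insubd 1 y).
    by rewrite insubdK //; exact: sub_generated.
  by apply: sK; apply: map_f; rewrite As in Ay.
by have /asboolP[z /val_inj <-] := genK _ (valP x).
Qed.
End Generated.

(** * The colouring bijection along an exhaustion *)

Section Exhaustion.
Variables (R : realType) (G : properGroupType R) (T : normalClosed G).
Variable Gn : nat -> groupClosed G.
Hypotheses (cG : countable_group G) (abT : abelian_group (quotient_group T)).
Hypothesis Gn0 : forall x, x \in Gn 0 -> x = 1.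
Hypothesis GnS : forall n, {subset Gn n <= Gn n.+1}.
Hypothesis GnU : forall x, exists n, x \in Gn n.
Hypothesis finT : forall n, finite_set [set x | x \in T /\ x \in Gn n].

Local Notation pi := (coset_pi T).

Lemma Gn_le m n : (m <= n)%N -> {subset Gn m <= Gn n}.
Proof.
move=> mn x xm; rewrite -(subnK mn); elim: (n - m)%N => // k IHk.
exact: GnS.
Qed.

(** The product of [T \cap G_{n+1}] and [G_n], expressed through classes modulo [T]. *)
Definition saturation_pred n : {pred G} := fun x =>
  `[< x \in Gn n.+1 /\ exists2 y, y \in Gn n & pi x = pi y >].

Lemma saturation_closed n : group_closed (saturation_pred n).
Proof.
split.
  by apply/asboolP; split; [exact: gpred1 | exists 1; rewrite ?gpred1].
move=> x y /asboolP[xn [x' x'n xx']] /asboolP[yn [y' y'n yy']].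
apply/asboolP; split; first exact: gpredF.
by exists (x' / y'); [exact: gpredF | rewrite !gmulfF /= xx' yy'].
Qed.

Definition is_coloring n k (u : G -> 'I_k.+1) : Prop :=
  [/\ forall x, x \in Gn n -> u x = 1,
    forall x y, x^-1 * y \in Gn n -> u x = u y,
    forall x y, x^-1 * y \in saturation_pred n -> u x = u y ->
      x^-1 * y \in Gn n &
    forall x i, exists2 d, d \in T /\ d \in Gn n.+1 & u (x * d) = i].

Lemma coloring_exists n : exists k (u : G -> 'I_k.+1), is_coloring n u.
Proof.
apply: (coset_coloring (L := group_closed_of (saturation_closed n))
  (D := [set d | d \in T /\ d \in Gn n.+1])).
- by move=> x xn; apply/asboolP; split; [exact: GnS | exists x].
- exact: finT.
- move=> d [/coset_pi_eq1 dT dn]; apply/asboolP; split=> //.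
  by exists 1; rewrite ?gpred1 // dT gmulf1.
- move=> l /asboolP[ln [x xn lx]]; exists (l / x).
    split; last by rewrite gpredF // GnS.
    by apply/coset_pi_eq1; rewrite gmulfF /= lx divgg.
  by rewrite invgM invgK mulgVK.
Qed.

Lemma exhaustion_coarsely_abelian : coarsely_abelian G.
Proof.
have /choice[ku kuP] n : exists ku : {k & G -> 'I_k.+1},
    is_coloring n (tagged ku).
  by have [k [u uP]] := coloring_exists n; exists (Tagged _ u).
pose m n := tag (ku n).
pose u n : G -> 'I_(m n).+1 := tagged (ku n).
have u1 n x : x \in Gn n -> u n x = 1 by have [+ _ _ _] := kuP n; apply.
have uK n x y : x^-1 * y \in Gn n -> forall k, (n <= k)%N -> u k x = u k y.
  by move=> xy k /Gn_le/(_ _ xy); have [_ + _ _] := kuP k; apply.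
(* Descent from some [Gn N] containing [x^-1 * y]: at each stage above [n] the class condition puts
   it in the saturation, and equal colours put it one subgroup lower. *)
have u_inj n x y : (exists2 z, z \in Gn n & pi (x^-1 * y) = pi z) ->
    (forall k, (n <= k)%N -> u k x = u k y) -> x^-1 * y \in Gn n.
  move=> [z zn xyz] uxy; have [N] := GnU (x^-1 * y).
  elim: N => [|N IHN]; first exact: (Gn_le (leq0n n)).
  have [Nn|nN] := leqP N.+1 n; first exact: (Gn_le Nn).
  move=> xyN; apply: IHN; have [_ _ + _] := kuP N; apply; last exact: uxy.
  by apply/asboolP; split=> //; exists z => //; exact: Gn_le zn.
(* Colours are corrected from the top down: multiplying by a suitable element of [T] in [Gn n.+1]
   sets colour [n] and changes neither the class nor the colours above [n]. *)
have u_surj n x (e : direct_sum (fun n => 'I_(m n).+1)) :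
    (forall k, (n <= k)%N -> u k x = e k) ->
    exists2 y, pi y = pi x & forall k, u k y = e k.
  elim: n x => [|n IHn] x ux; first by exists x => // k; exact: ux.
  have [_ _ _ /(_ x (e n))[d [dT dn] ud]] := kuP n.
  have [|y yx uy] := IHn (x * d).
    move=> k; rewrite leq_eqVlt => /orP[/eqP<-//|nk].
    by rewrite -(ux k nk); symmetry; apply: (uK n.+1); rewrite // mulKg.
  exists y => //; rewrite yx gmulfM /=; move/coset_pi_eq1: dT => ->.
  by rewrite mulg1.
have u_fin x : exists N, forall n, (N <= n)%N -> u n x = 1.
  by have [N xN] := GnU x; exists N => n Nn; apply: u1; exact: Gn_le xN.
pose phi x : quotient_group T * direct_sum (fun n => 'I_(m n).+1) :=
  (pi x, DirectSum (u_fin x)).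
have phi_inj x y : phi x = phi y -> x = y.
  move=> xy; have pixy : pi x = pi y by exact: (congr1 fst xy).
  have uxy k : u k x = u k y.
    exact: (congr1 (fun b : _ * direct_sum _ => b.2 k) xy).
  have /Gn0/mulg1_eq : x^-1 * y \in Gn 0; last by rewrite invgK.
  apply: u_inj => // ; exists 1; first exact: gpred1.
  by rewrite gmulfM gmulfV /= pixy mulVg gmulf1.
have phi_surj b : exists x, phi x = b.
  case: b => b e; have [N eN] := component_eventually1 e.
  have [M bM] := GnU (coset_repr b).
  (* From this index on, the colours of [coset_repr b] and the entries of [e] are all 1. *)
  have [|x xb ux] := u_surj (maxn M N) (coset_repr b) e.
    move=> k; rewrite geq_max => /andP[Mk Nk]; rewrite eN // u1 //.
    exact: Gn_le bM.
  exists x; congr (_, _); first by rewrite xb coset_reprK.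
  exact: direct_sum_ext.
have [psi psiK] := choice phi_surj.
have phiK : cancel phi psi by move=> x; apply: phi_inj; rewrite psiK.
apply: (coarsely_abelian_transport cG _ phiK psiK) => [|c|[b e]].
- move=> [a e] [b f]; congr (_, _); first exact: abT.
  by apply: direct_sum_ext => n; exact: Zp_mulgC.
(* From index [n] on, [g] and [g * c] have the same colours, so the quotient is [pi c] paired with
   an element supported below [n]. *)
- have [n cn] := GnU c.
  apply: sub_finite_set
    (finite_image (fun e => (pi c, e)) (cyclic_sum_finite m n)).
  move=> _ [g _ <-]; exists ((phi g).2^-1 * (phi (g * c)).2).
    move=> k nk; rewrite -[LHS]/((u k g)^-1 * u k (g * c)).
    by rewrite (uK n g (g * c)) ?mulVg // mulKg.
  congr (_, _); rewrite -[RHS]/((pi g)^-1 * pi (g * c)).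
  by rewrite gmulfM mulKg.
(* The element [x^-1 * y] has the class of [coset_repr b], and lies in [Gn n] because the colours of
   [x] and [y] agree from [n] on; this confines it to a translate of the finite set [T \cap G_n]. *)
- have [N eN] := component_eventually1 e.
  have [M bM] := GnU (coset_repr b); pose n := maxn N M.
  apply: sub_finite_set (finite_image (fun x => coset_repr b * x) (finT n)).
  move=> _ [[a f] _ <-]; set x := psi (a, f); set y := psi _.
  have pix : pi x = a by exact: (congr1 fst (psiK (a, f))).
  have ux k : u k x = f k.
    exact: (congr1 (fun c : _ * direct_sum _ => c.2 k) (psiK (a, f))).
  have piy : pi y = a * b by exact: (congr1 fst (psiK ((a, f) * (b, e)))).
  have uy k : u k y = f k * e k.
    exact: (congr1 (fun c : _ * direct_sum _ => c.2 k)
      (psiK ((a, f) * (b, e)))).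
  have pixy : pi (x^-1 * y) = pi (coset_repr b).
    by rewrite coset_reprK gmulfM gmulfV /= pix piy mulKg.
  have xyn : x^-1 * y \in Gn n.
    apply: u_inj => [|k].
      by exists (coset_repr b); rewrite ?(Gn_le (leq_maxr N M)).
    by rewrite geq_max => /andP[Nk _]; rewrite ux uy eN // mulg1.
  exists ((coset_repr b)^-1 * (x^-1 * y)); last by rewrite mulVKg.
  split; last by rewrite gpredM // gpredV (Gn_le (leq_maxr N M)).
  by apply/coset_pi_eq1; rewrite gmulfM gmulfV /= pixy mulVg.
Qed.
End Exhaustion.

(** * The torsion subgroup of a locally finite-by-abelian group *)

Lemma subgroup_torsion (G : groupType) (H : groupClosed G) (x : subgroup_of H) :
  torsion x <-> torsion (val x).
Proof.
split=> -[n n0 xn]; exists n => //; first by rewrite -gmulfXn xn gmulf1.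
by apply: val_inj; rewrite gmulfXn gmulf1.
Qed.

Section LocallyFiniteByAbelian.
Variables (G : groupType) (lfabG : locally finite_by_abelian G).

(** Products of torsion elements and commutators involve two elements at a time, so the local
    hypothesis is applied to two-generator subgroups. *)
Lemma generated_pair (x y : G) : exists H : groupClosed G,
  [/\ x \in H, y \in H & finite_by_abelian (subgroup_of H)].
Proof.
exists (generated [set x; y]); split.
- by apply: sub_generated; left.
- by apply: sub_generated; right.
- by apply/lfabG/generated_finitely_generated/finite_set2.
Qed.

Lemma locally_torsionM (x y : G) : torsion x -> torsion y -> torsion (x * y).
Proof.
move=> tx ty; have [H [xH yH fabH]] := generated_pair x y.
rewrite -[x](SubK (subgroup_of H) xH) -[y](SubK (subgroup_of H) yH) -valM.
apply/subgroup_torsion/(finite_by_abelian_torsionM fabH);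
  by apply/subgroup_torsion; rewrite SubK.
Qed.

Lemma locally_torsion_commg (x y : G) : torsion [~ x, y].
Proof.
have [H [xH yH fabH]] := generated_pair x y.
rewrite -[x](SubK (subgroup_of H) xH) -[y](SubK (subgroup_of H) yH) -gmulfR.
exact/subgroup_torsion/finite_by_abelian_torsion_commg.
Qed.

Definition torsion_pred : {pred G} := fun x => `[< torsion x >].

Lemma torsion_closed : group_closed torsion_pred.
Proof.
split; first by apply/asboolP; exists 1%N.
move=> x y /asboolP tx /asboolP ty; apply/asboolP.
exact: locally_torsionM (torsionV ty).
Qed.

Lemma torsion_normal x y :
  y \in group_pred torsion_closed -> y ^ x \in group_pred torsion_closed.
Proof.
move=> /asboolP[n n0 yn]; apply/asboolP; exists n => //.
by rewrite -conjXg yn conj1g.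
Qed.

HB.instance Definition _ := isNormalClosed.Build G (group_pred torsion_closed)
  torsion_normal.

Definition torsion_subgroup : normalClosed G :=
  [the normalClosed G of group_pred torsion_closed].

Lemma torsion_quotient_abelian :
  abelian_group (quotient_group torsion_subgroup).
Proof.
move=> a b; rewrite -(coset_reprK a) -(coset_reprK b).
apply/commgP; rewrite -gmulfR; apply/eqP/coset_pi_eq1/asboolP.
exact: locally_torsion_commg.
Qed.

Lemma generated_torsion_finite (A : set G) : finite_set A ->
  finite_set [set x | x \in torsion_subgroup /\ x \in generated A].
Proof.
move=> /generated_finitely_generated fgA.
have := finite_by_abelian_torsion_finite (lfabG fgA) fgA.
move=> /(finite_image val); apply: sub_finite_set => x [/asboolP tx xA].
exists (Sub x xA); rewrite ?SubK //.
by apply/subgroup_torsion; rewrite SubK.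
Qed.

End LocallyFiniteByAbelian.

Lemma locally_finite_by_abelian_coarsely_abelian (R : realType)
    (G : properGroupType R) :
  countable_group G -> locally finite_by_abelian G -> coarsely_abelian G.
Proof.
move=> cG lfabG; have /countable_injP[c c_inj] := cG.
(* The inequality is strict so that [A 0] is empty and the exhaustion starts with the trivial
   subgroup. *)
pose A n := [set x : G | (c x < n)%N].
have finA n : finite_set (A n).
  rewrite -(@eq_finite_set _ _ (c @` A n)).
    by apply: sub_finite_set (finite_II n) => _ [x xn <-].
  by apply: inj_card_eq => x y _ _; apply: c_inj; rewrite inE.
apply: (@exhaustion_coarsely_abelian R G (torsion_subgroup lfabG)
  (fun n => generated (A n)) cG).
- exact: torsion_quotient_abelian.
- move=> x /(@generated_min _ _ (group_closed_of (trivial_closed G))).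
  by move=> H; apply/eqP/H.
- move=> n x; apply: generated_min => y yn; apply: sub_generated.
  exact: ltnW.
- by move=> x; exists (c x).+1; apply: sub_generated; rewrite /A /=.
- by move=> n; exact: generated_torsion_finite.
Qed.

Theorem theorem2 (R : realType) (G : properGroupType R) :
  countable_group G ->
  abelian_by_finite G \/ locally finite_by_abelian G ->
  exists A : properGroupType R,
    [/\ countable_group A, abelian_group A &
        bijectively_coarsely_equivalent G A].
Proof.
move=> cG [abfG|lfabG]; first exact: abelian_by_finite_coarsely_abelian.
exact: locally_finite_by_abelian_coarsely_abelian.
Qed.
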